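(* Let $0<z<\frac{\pi}{6}$, $-1<a<1$, and let $k\ge 0$ be an integer. Then $$\sum_{n=1}^\infty \frac{H_{n-1}^{[k]}}{n+a}\left(1-e^{-2iz}\right)^n = \frac{(2i)^{k+1}}{k!}\int_0^z t^k\,\exp\left(a\left[\log\left(\frac{\sin t}{\sin z}\right)+i(z-t)\right]\right)dt.$$
   Context: The multiple harmonic numbers are $H_{n-1}^{[k]}=\sum_{n>n_1>\cdots>n_k\ge 1}\frac{1}{n_1\cdots n_k}$ (sum over positive integers $n_1,\dots,n_k$), with $H_{n-1}^{[0]}=1$; an empty sum is $0$. Here $i$ is the imaginary unit, $\log$ is the real logarithm of the positive number $\sin t/\sin z$, $t^0=1$, and for $a<0$ the integral may be improper (absolutely convergent) at $t=0$. *)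

(* Defs.v *)
From Stdlib Require Import Reals Lra Lia List Sorted.
From Coquelicot Require Import Coquelicot.
Import ListNotations.
Open Scope R_scope.

(* The index set of the sum defining H_m^[k], i.e. the duplicate-free list of
   all [n_1; ...; n_k] with m >= n_1 > ... > n_k >= 1; see the two lemmas
   below. *)
Fixpoint decr_tuples (k m : nat) : list (list nat) :=
  match k with
  | O => [[]]
  | S k' => flat_map (fun j => map (cons j) (decr_tuples k' (j - 1))) (seq 1 m)
  end.

Lemma in_decr_tuples (k m : nat) (l : list nat) :
  In l (decr_tuples k m) <->
  length l = k /\ StronglySorted gt l /\
  List.Forall (fun j => (1 <= j <= m)%nat) l.
Proof.
revert m l; induction k as [|k IH]; intros m l; simpl.
- split.
  + intros [<-|[]]; repeat constructor.
  + intros [Hl _]; left; now destruct l.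
- rewrite in_flat_map; split.
  + intros [j [Hj Hl]]; apply in_seq in Hj; apply in_map_iff in Hl.
    destruct Hl as [l' [<- Hl']]; apply IH in Hl'.
    destruct Hl' as [Hk [Hs Hb]]; simpl; rewrite Hk; repeat split.
    * constructor; [exact Hs|].
      eapply Forall_impl; [|exact Hb]; simpl; intros; lia.
    * constructor; [lia|].
      eapply Forall_impl; [|exact Hb]; simpl; intros; lia.
  + intros [Hk [Hs Hb]]; destruct l as [|j l]; [discriminate|].
    inversion Hs as [|? ? Hs' Hj]; subst; inversion Hb as [|? ? Hj1 Hb']; subst.
    exists j; split; [apply in_seq; lia|].
    apply in_map, IH; repeat split; [now injection Hk|exact Hs'|].
    rewrite Forall_forall in *; intros i Hi.
    specialize (Hj i Hi); specialize (Hb' i Hi); simpl in *; lia.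
Qed.

Lemma NoDup_decr_tuples (k m : nat) : NoDup (decr_tuples k m).
Proof.
revert m; induction k as [|k IH]; intros m; simpl.
- repeat constructor; intros [].
- generalize (seq_NoDup m 1); generalize (seq 1 m) as s.
  induction s as [|j s IHs]; intros Hs; simpl; [constructor|].
  inversion Hs as [|? ? Hj Hs']; subst.
  apply NoDup_app.
  + apply NoDup_map_NoDup_ForallPairs; [|apply IH].
    intros x y _ _ E; now injection E.
  + now apply IHs.
  + intros l Hl Hl'; apply in_map_iff in Hl; destruct Hl as [l1 [<- _]].
    apply in_flat_map in Hl'; destruct Hl' as [i [Hi Hl']].
    apply in_map_iff in Hl'; destruct Hl' as [l2 [E _]].
    injection E; intros; subst; contradiction.
Qed.

Definition list_sum_R (l : list R) : R := fold_right Rplus 0 l.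
Definition list_prod_R (l : list R) : R := fold_right Rmult 1 l.

(* H_m^[k] *)
Definition mharm (k m : nat) : R :=
  list_sum_R
    (map (fun l : list nat => 1 / list_prod_R (map INR l)) (decr_tuples k m)).

Definition Cexp (w : C) : C := (exp (Re w) * (cos (Im w), sin (Im w)))%C.

Definition integrand (k : nat) (a z t : R) : C :=
  (t ^ k * Cexp (a * (ln (sin t / sin z) + Ci * (z - t))))%C.

(* Integrals over (0, z], improper at 0. *)
Definition abs_integrable_0 (f : R -> C) (z : R) : Prop :=
  ex_RInt_gen (V := C_R_CompleteNormedModule) f (at_right 0) (at_point z) /\
  ex_RInt_gen (fun t => Cmod (f t)) (at_right 0) (at_point z).

Definition CInt_0 (f : R -> C) (z : R) : C :=
  RInt_gen (V := C_R_CompleteNormedModule) f (at_right 0) (at_point z).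

(* Main.v *)
Require Import Defs.
From Stdlib Require Import Reals Lra Lia List Factorial.
From Coquelicot Require Import Coquelicot.
Open Scope R_scope.

(** Write [x(t) = 1 - e^(-2it)], so that [- log (1 - x(t)) = 2it] and
    [x' = 2i (1 - x)].  The classical generating function
    [sum_(m >= 0) H_m^[k] x^m = (- log (1 - x))^k / (k! (1 - x))]
    then reads [(1 - x(t)) * sum_m H_m^[k] x(t)^m = (2it)^k / k!].  On the other
    hand [E(t) = exp (a (log (sin t / sin z) + i (z - t)))] is a branch of
    [(x(t) / x(z))^a]: its logarithmic derivative is [a (cot t - i)], which is
    [a x' / x].  Hence [(E x^n)' = (n + a) E x^(n-1) x'], the factor [n + a]
    cancels the denominator of the series, and
    [sum_n H_(n-1)^[k] / (n + a) E x^n] is a primitive of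
    [2i E (1 - x) sum_m H_m^[k] x^m = (2i)^(k+1) / k! t^k E].
    At [t = z] one has [E = 1], which gives the series of the theorem, and at
    [t = 0] the primitive vanishes because [n + a > 0].

    To justify the termwise integration, the argument is run on partial sums,
    with a geometric error.  For [z < PI / 6] one has
    [|x(t)| = 2 sin t <= r < 1] on [[0, z]].  By [hsum_arc_approx], the truncated
    generating function times [1 - x(t)] differs from [(2it)^k / k!] by
    [O(q^N)], uniformly on [[0, z]], for some [q < 1].  This is an induction on
    [k]: multiplication by [1 - x] turns the sum of order [k + 1] into a
    telescoped sum whose derivative along [x(t)] is [2i (1 - x)] times the sum of
    order [k], up to a tail controlled by [mharm_le_geom].

    The singularity at [0] is handled by one increasing function,
    [majorant], a multiple of [(sin t / sin z)^(a+1)].  It tends to [0] at [0]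
    since [a > -1], and its derivative dominates the integrand.  So the improper
    integrals converge ([dominated_RInt_gen_at_0]), and two functions whose
    derivatives are within [eps] times that derivative have increments
    within [eps * majorant z] ([at_right_0_primitive_close]); here [eps] is the
    geometric error above. *)

(** * Complex-valued functions of a real variable *)

Local Notation is_Cderive := (@is_derive R_AbsRing C_R_NormedModule).
Local Notation Csum := (@sum_n C_Ring).

(** The product and exponential rules below are reduced to real calculus on the
    two components. *)
Lemma is_Cderive_iff (f : R -> C) (t : R) (l : C) :
  is_Cderive f t l <->
  is_derive (fun s => Re (f s)) t (Re l) /\
  is_derive (fun s => Im (f s)) t (Im l).
Proof.
split.
- intros Hf; split.
  + exact (filterdiff_comp' _ _ t _ _ Hf
             (filterdiff_linear _
                (is_linear_fst (U := R_NormedModule) (V := R_NormedModule)))).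
  + exact (filterdiff_comp' _ _ t _ _ Hf
             (filterdiff_linear _
                (is_linear_snd (U := R_NormedModule) (V := R_NormedModule)))).
- intros [Hr Hi].
  apply (is_derive_scal_l (V := C_R_NormedModule) _ t _ (RtoC 1)) in Hr.
  apply (is_derive_scal_l (V := C_R_NormedModule) _ t _ Ci) in Hi.
  generalize (is_derive_plus _ _ t _ _ Hr Hi); intros H.
  replace l with (plus (scal (V := C_R_NormedModule) (Re l) (RtoC 1))
                       (scal (V := C_R_NormedModule) (Im l) Ci)).
  + revert H; apply is_derive_ext; intros s.
    apply injective_projections; cbn; unfold mult; simpl; unfold Re, Im; ring.
  + apply injective_projections; cbn; unfold mult; simpl; unfold Re, Im; ring.
Qed.

Lemma is_Cderive_const (c : C) (t : R) : is_Cderive (fun _ => c) t (RtoC 0).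
Proof. exact (@is_derive_const R_AbsRing C_R_NormedModule c t). Qed.

Lemma is_Cderive_RtoC (f : R -> R) (t l : R) :
  is_derive f t l -> is_Cderive (fun s => RtoC (f s)) t (RtoC l).
Proof.
intros Hf; apply is_Cderive_iff; simpl; split; [exact Hf|].
exact (is_derive_const (V := R_NormedModule) 0 t).
Qed.

Lemma is_Cderive_plus (f g : R -> C) (t : R) (lf lg : C) :
  is_Cderive f t lf -> is_Cderive g t lg ->
  is_Cderive (fun s => f s + g s)%C t (lf + lg)%C.
Proof. exact (is_derive_plus f g t lf lg). Qed.

Lemma is_Cderive_minus (f g : R -> C) (t : R) (lf lg : C) :
  is_Cderive f t lf -> is_Cderive g t lg ->
  is_Cderive (fun s => f s - g s)%C t (lf - lg)%C.
Proof. exact (is_derive_minus f g t lf lg). Qed.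

Lemma is_Cderive_mult (f g : R -> C) (t : R) (lf lg : C) :
  is_Cderive f t lf -> is_Cderive g t lg ->
  is_Cderive (fun s => f s * g s)%C t (lf * g t + f t * lg)%C.
Proof.
rewrite !is_Cderive_iff; intros [Hf1 Hf2] [Hg1 Hg2].
pose proof (fun u v du dv => is_derive_mult (K := R_AbsRing) u v t du dv) as Hm.
split.
- replace (Re (lf * g t + f t * lg)%C) with
    (Re lf * Re (g t) + Re (f t) * Re lg - (Im lf * Im (g t) + Im (f t) * Im lg))
    by (unfold Re, Im; simpl; ring).
  exact (is_derive_minus _ _ t _ _ (Hm _ _ _ _ Hf1 Hg1 Rmult_comm)
           (Hm _ _ _ _ Hf2 Hg2 Rmult_comm)).
- replace (Im (lf * g t + f t * lg)%C) with
    (Re lf * Im (g t) + Re (f t) * Im lg + (Im lf * Re (g t) + Im (f t) * Re lg))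
    by (unfold Re, Im; simpl; ring).
  exact (is_derive_plus _ _ t _ _ (Hm _ _ _ _ Hf1 Hg2 Rmult_comm)
           (Hm _ _ _ _ Hf2 Hg1 Rmult_comm)).
Qed.

Lemma is_Cderive_scal (c : C) (f : R -> C) (t : R) (l : C) :
  is_Cderive f t l -> is_Cderive (fun s => c * f s)%C t (c * l)%C.
Proof.
intros Hf; replace (c * l)%C with (0 * f t + c * l)%C by ring.
apply is_Cderive_mult; [apply is_Cderive_const|exact Hf].
Qed.

Lemma is_Cderive_pow (f : R -> C) (n : nat) (t : R) (l : C) :
  is_Cderive f t l ->
  is_Cderive (fun s => f s ^ n)%C t (INR n * f t ^ pred n * l)%C.
Proof.
intros Hf; induction n as [|n IH].
- replace (INR 0 * f t ^ pred 0 * l)%C with (RtoC 0) by (simpl; ring).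
  exact (is_Cderive_const 1 t).
- eapply is_derive_ext; [intros s; symmetry; apply Cpow_S|].
  replace (INR (S n) * f t ^ pred (S n) * l)%C with
    (l * f t ^ n + f t * (INR n * f t ^ pred n * l))%C.
  + now apply is_Cderive_mult.
  + rewrite (S_INR n), RtoC_plus; destruct n;
      [simpl; ring|cbn [pred Cpow]; ring].
Qed.

Lemma is_Cderive_sum (f : nat -> R -> C) (l : nat -> C) (N : nat) (t : R) :
  (forall n, is_Cderive (f n) t (l n)) ->
  is_Cderive (fun s => Csum (fun n => f n s) N) t (Csum l N).
Proof.
intros Hf; induction N as [|N IH].
- rewrite sum_O; eapply is_derive_ext; [|apply Hf].
  intros s; symmetry; apply (sum_O (G := C_Ring)).
- rewrite sum_Sn; eapply is_derive_ext;
    [intros s; symmetry; apply (sum_Sn (G := C_Ring))|].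
  now apply is_Cderive_plus.
Qed.

Lemma is_Cderive_Cexp (f : R -> C) (t : R) (l : C) :
  is_Cderive f t l -> is_Cderive (fun s => Cexp (f s)) t (l * Cexp (f t))%C.
Proof.
intros Hf.
assert (Hreal : forall u v : R -> R, is_derive u t (Re l) ->
  is_derive v t (Im l) ->
  is_derive (fun s => exp (u s) * cos (v s)) t
    (exp (u t) * (Re l * cos (v t) - Im l * sin (v t))) /\
  is_derive (fun s => exp (u s) * sin (v s)) t
    (exp (u t) * (Re l * sin (v t) + Im l * cos (v t)))).
{ intros u v Hu Hv.
  assert (Eu : ex_derive u t) by (eexists; exact Hu).
  assert (Ev : ex_derive v t) by (eexists; exact Hv).
  apply is_derive_unique in Hu; apply is_derive_unique in Hv.
  split; auto_derive; try (now repeat split);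
    change (Derive (fun s => u s) t) with (Derive u t);
    change (Derive (fun s => v s) t) with (Derive v t); rewrite Hu, Hv; ring. }
revert Hf; rewrite !is_Cderive_iff; intros [Hr Hi].
destruct (Hreal _ _ Hr Hi) as [H1 H2]; split.
- replace (Re (l * Cexp (f t))%C) with
    (exp (Re (f t)) * (Re l * cos (Im (f t)) - Im l * sin (Im (f t))))
    by (unfold Cexp, Re, Im; simpl; ring).
  revert H1; apply is_derive_ext; intros s; unfold Cexp, Re, Im; simpl; ring.
- replace (Im (l * Cexp (f t))%C) with
    (exp (Re (f t)) * (Re l * sin (Im (f t)) + Im l * cos (Im (f t))))
    by (unfold Cexp, Re, Im; simpl; ring).
  revert H2; apply is_derive_ext; intros s; unfold Cexp, Re, Im; simpl; ring.
Qed.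

Lemma is_Cderive_continuous (f : R -> C) (t : R) (l : C) :
  is_Cderive f t l -> continuous (U := C_R_NormedModule) f t.
Proof. intros Hf; apply ex_derive_continuous; eexists; exact Hf. Qed.

(** The integral is built from the real vector space structure of [C], so
    linearity over complex scalars has to go through components. *)
Lemma is_RInt_Cscal (c : C) (f : R -> C) (u v : R) (l : C) :
  is_RInt (V := C_R_NormedModule) f u v l ->
  is_RInt (V := C_R_NormedModule) (fun t => c * f t)%C u v (c * l)%C.
Proof.
intros Hf.
pose proof (is_RInt_fct_extend_fst (U := R_NormedModule) (V := R_NormedModule)
              _ _ _ _ Hf) as Hr.
pose proof (is_RInt_fct_extend_snd (U := R_NormedModule) (V := R_NormedModule)
              _ _ _ _ Hf) as Hi.
apply (is_RInt_fct_extend_pair (U := R_NormedModule) (V := R_NormedModule)).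
- exact (is_RInt_minus _ _ _ _ _ _
           (is_RInt_scal _ _ _ (fst c) _ Hr) (is_RInt_scal _ _ _ (snd c) _ Hi)).
- exact (is_RInt_plus _ _ _ _ _ _
           (is_RInt_scal _ _ _ (fst c) _ Hi) (is_RInt_scal _ _ _ (snd c) _ Hr)).
Qed.

(** A mean value inequality; a complex-valued function satisfies no mean value
    equality, so the bound comes from integrating the derivative. *)
Lemma Cmod_le_of_deriv (f df : R -> C) (t M : R) :
  0 <= t -> f 0 = 0 ->
  (forall s, 0 <= s <= t -> is_Cderive f s (df s)) ->
  (forall s, 0 <= s <= t -> continuous (U := C_R_NormedModule) df s) ->
  (forall s, 0 <= s <= t -> Cmod (df s) <= M) ->
  Cmod (f t) <= t * M.
Proof.
intros Ht Hf0 Hf Hc HM.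
assert (HI : is_RInt (V := C_R_NormedModule) df 0 t (f t - f 0)%C).
{ apply (is_RInt_derive (V := C_R_CompleteNormedModule));
    rewrite Rmin_left, Rmax_right by lra; assumption. }
rewrite Hf0 in HI; replace (f t - 0)%C with (f t) in HI by ring.
replace (t * M) with ((t - 0) * M) by ring; rewrite Cmod_norm.
refine (norm_RInt_le_const (V := C_R_NormedModule) df 0 t (f t) M Ht _ HI).
intros s Hs; eapply Rle_trans; [|apply (HM s Hs)].
right; symmetry; exact (Cmod_norm (df s)).
Qed.

(** * Integrals that are improper at 0 *)

Lemma is_RInt_gen_at_right_0 (V : CompleteNormedModule R_AbsRing)
  (f : R -> V) (z : R) (l : V) :
  0 < z -> (forall t, 0 < t <= z -> continuous f t) ->
  filterlim (fun d => RInt f d z) (at_right 0) (locally l) ->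
  is_RInt_gen f (at_right 0) (at_point z) l.
Proof.
intros Hz Hc Hl P HP; apply Hl in HP; unfold filtermap in HP.
exists (fun d => 0 < d <= z /\ P (RInt f d z)) (fun y => y = z).
- apply filter_and; [|exact HP].
  exists (mkposreal z Hz); intros y Hy Hy0; split; [exact Hy0|].
  change (Rabs (y - 0) < z) in Hy; apply Rabs_def2 in Hy; lra.
- reflexivity.
- intros d y [Hd HPd] ->; exists (RInt f d z); split; [|exact HPd].
  apply RInt_correct, ex_RInt_continuous; intros t; simpl.
  rewrite Rmin_left, Rmax_right by lra; intros Ht; apply Hc; lra.
Qed.

(** The domination hypothesis gives
    [|int_u^v f| <= g v - g u], and [g] has a limit at [0], so the truncated
    integrals satisfy Cauchy's criterion.  Asking for a primitive [g] of the
    dominating function avoids any integrability hypothesis on the latter. *)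
Lemma dominated_RInt_gen_at_0 (V : CompleteNormedModule R_AbsRing)
  (f : R -> V) (g dg : R -> R) (z : R) :
  0 < z ->
  (forall t, 0 < t <= z -> continuous f t) ->
  (forall t, 0 < t <= z -> is_derive g t (dg t)) ->
  (forall t, 0 < t <= z -> continuous dg t) ->
  (forall t, 0 < t <= z -> norm (f t) <= dg t) ->
  filterlim g (at_right 0) (locally 0) ->
  exists l, filterlim (fun d => RInt f d z) (at_right 0) (locally l).
Proof.
intros Hz Hf Hg Hdg Hfg Hg0.
apply (proj1 (filterlim_locally_cauchy (U := V) (F := at_right 0) _)).
intros eps.
assert (Hnear : at_right 0 (fun d => 0 < d <= z /\ ball 0 (pos_div_2 eps) (g d))).
{ apply filter_and.
  - exists (mkposreal z Hz); intros y Hy Hy0; split; [exact Hy0|].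
    change (Rabs (y - 0) < z) in Hy; apply Rabs_def2 in Hy; lra.
  - exact (proj1 (filterlim_locally g 0) Hg0 (pos_div_2 eps)). }
exists (fun d => 0 < d <= z /\ ball 0 (pos_div_2 eps) (g d)).
split; [exact Hnear|].
assert (Hex : forall u v, 0 < u -> u <= v <= z -> ex_RInt f u v).
{ intros u v Hu Hv; apply ex_RInt_continuous; intros t.
  rewrite Rmin_left, Rmax_right by lra; intros Ht; apply Hf; lra. }
assert (Hwlog : forall u v, u <= v ->
  0 < u <= z /\ ball 0 (pos_div_2 eps) (g u) ->
  0 < v <= z /\ ball 0 (pos_div_2 eps) (g v) ->
  ball (RInt f v z) eps (RInt f u z)).
{ intros u v Huv [Hu Hgu] [Hv Hgv].
  change (Rabs (g u - 0) < eps / 2) in Hgu.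
  change (Rabs (g v - 0) < eps / 2) in Hgv.
  apply (norm_compat1 (V := V)).
  rewrite <- (RInt_Chasles f u v z) by (apply Hex; lra).
  unfold minus; rewrite <- plus_assoc.
  rewrite (plus_opp_r (G := V)), (plus_zero_r (G := V)).
  apply Rle_lt_trans with (minus (g v) (g u)).
  - apply (norm_RInt_le f dg u v); [exact Huv| | |].
    + intros t Ht; apply Hfg; lra.
    + apply RInt_correct, Hex; lra.
    + apply (is_RInt_derive g dg); rewrite Rmin_left, Rmax_right by exact Huv;
        intros t Ht; [apply Hg|apply Hdg]; lra.
  - unfold minus, plus, opp; simpl.
    apply Rabs_def2 in Hgu; apply Rabs_def2 in Hgv; lra. }
intros u v Hu Hv; destruct (Rle_dec u v) as [Huv|Huv].
- apply ball_sym; now apply Hwlog.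
- apply Hwlog; [lra|exact Hv|exact Hu].
Qed.

(** Integrating [|F' - c f| <= eps g'] over [[d, z]] gives
    [|F z - F d - c int_d^z f| <= eps (g z - g d)]; now let [d] tend to [0],
    where [g], hence also [F], vanishes. *)
Lemma at_right_0_primitive_close (f F dF : R -> C) (g dg : R -> R)
  (c l : C) (z M eps : R) :
  0 < z ->
  (forall t, 0 < t <= z -> continuous (U := C_R_NormedModule) f t) ->
  (forall t, 0 < t <= z -> is_Cderive F t (dF t)) ->
  (forall t, 0 < t <= z -> continuous (U := C_R_NormedModule) dF t) ->
  (forall t, 0 < t <= z -> is_derive g t (dg t)) ->
  (forall t, 0 < t <= z -> continuous dg t) ->
  (forall t, 0 < t <= z -> Cmod (dF t - c * f t) <= eps * dg t) ->
  (forall t, 0 < t <= z -> Cmod (F t) <= M * g t) ->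
  filterlim g (at_right 0) (locally 0) ->
  filterlim (fun d => RInt (V := C_R_CompleteNormedModule) f d z)
    (at_right 0) (locally (l : C_R_NormedModule)) ->
  Cmod (F z - c * l) <= eps * g z.
Proof.
intros Hz Hf HF HdF Hg Hdg Hclose HFg Hg0 Hl.
apply le_epsilon; intros e He.
pose proof (Cmod_ge_0 c) as Hc0.
pose proof (Rabs_pos M) as HM0; pose proof (Rabs_pos eps) as He0.
(* Letting d tend to 0 costs |F d|, |c| |I - l| and |eps g d|; each of
   g d and I - l is made smaller than e / D. *)
set (D := Cmod c + Rabs M + Rabs eps + 1).
assert (HD : 0 < e / D) by (apply Rdiv_lt_0_compat; unfold D; lra).
assert (Hnear : at_right 0 (fun d => 0 < d <= z /\
  (ball 0 (mkposreal _ HD) (g d) /\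
   ball_norm (V := C_R_NormedModule) l (mkposreal _ HD)
     (RInt (V := C_R_CompleteNormedModule) f d z)))).
{ apply filter_and; [|apply filter_and].
  - exists (mkposreal z Hz); intros y Hy Hy0; split; [exact Hy0|].
    change (Rabs (y - 0) < z) in Hy; apply Rabs_def2 in Hy; lra.
  - exact (proj1 (filterlim_locally g 0) Hg0 _).
  - exact (proj1 (filterlim_locally_ball_norm (U := C_R_NormedModule) _ _) Hl _). }
destruct (filter_ex _ Hnear) as [d [Hd [Hgd Hld]]]; clear Hnear.
change (Rabs (g d - 0) < e / D) in Hgd.
set (I := RInt (V := C_R_CompleteNormedModule) f d z) in *.
assert (Hld' : Cmod (I - l) < e / D) by (rewrite Cmod_norm; exact Hld).
assert (HI : is_RInt (V := C_R_NormedModule) f d z I).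
{ apply (RInt_correct (V := C_R_CompleteNormedModule)),
    (ex_RInt_continuous (V := C_R_CompleteNormedModule)).
  intros t; rewrite Rmin_left, Rmax_right by lra; intros Ht; apply Hf; lra. }
assert (HdFI : is_RInt (V := C_R_NormedModule) dF d z (F z - F d)%C).
{ apply (is_RInt_derive (V := C_R_CompleteNormedModule));
    rewrite Rmin_left, Rmax_right by lra; intros t Ht;
    [apply HF|apply HdF]; lra. }
assert (HdgI : is_RInt dg d z (g z - g d)).
{ apply (is_RInt_derive (V := R_CompleteNormedModule));
    rewrite Rmin_left, Rmax_right by lra; intros t Ht;
    [apply Hg|apply Hdg]; lra. }
assert (Hmid : Cmod (F z - F d - c * I) <= eps * (g z - g d)).
{ rewrite Cmod_norm.
  refine (norm_RInt_le (V := C_R_NormedModule) _ (fun t => eps * dg t) d z _ _ _ _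
            (is_RInt_minus (V := C_R_NormedModule) _ _ _ _ _ _ HdFI
               (is_RInt_Cscal c _ _ _ _ HI))
            (is_RInt_scal (V := R_NormedModule) _ _ _ eps _ HdgI)); [lra|].
  intros t Ht; eapply Rle_trans; [|apply (Hclose t); lra].
  right; symmetry; exact (Cmod_norm (dF t - c * f t)%C). }
replace (F z - c * l)%C with ((F z - F d - c * I) + (F d + c * (I - l)))%C
  by ring.
eapply Rle_trans; [apply Cmod_triangle|].
pose proof (Cmod_triangle (F d) (c * (I - l))) as H1; rewrite Cmod_mult in H1.
pose proof (HFg d Hd) as H2.
assert (H3 : M * g d <= Rabs M * (e / D)).
{ eapply Rle_trans; [apply Rle_abs|]; rewrite Rabs_mult.
  apply Rmult_le_compat_l; [exact HM0|].
  rewrite Rminus_0_r in Hgd; lra. }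
assert (H4 : - (eps * g d) <= Rabs eps * (e / D)).
{ eapply Rle_trans; [apply Rle_abs|]; rewrite Rabs_Ropp, Rabs_mult.
  apply Rmult_le_compat_l; [exact He0|].
  rewrite Rminus_0_r in Hgd; lra. }
assert (H5 : Cmod c * Cmod (I - l) <= Cmod c * (e / D))
  by (apply Rmult_le_compat_l; lra).
assert (H6 : e = D * (e / D)) by (field; unfold D; lra).
unfold D in H6 at 1; lra.
Qed.

(** * Multiple harmonic numbers and their generating functions *)

Lemma list_sum_R_app (s t : list R) :
  list_sum_R (s ++ t) = list_sum_R s + list_sum_R t.
Proof. induction s as [|x s IH]; simpl; [|rewrite IH]; ring. Qed.

Lemma mharm_0 (m : nat) : mharm 0 m = 1.
Proof. unfold mharm, list_sum_R, list_prod_R; simpl; field. Qed.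

Lemma mharm_S_0 (k : nat) : mharm (S k) 0 = 0.
Proof. reflexivity. Qed.

(** The tuples bounded by [m + 1] are those bounded by [m], together with those
    whose largest entry is [m + 1]. *)
Lemma mharm_S_S (k m : nat) :
  mharm (S k) (S m) = mharm (S k) m + mharm k m / INR (S m).
Proof.
unfold mharm; cbn [decr_tuples]; rewrite seq_S, flat_map_app, map_app.
rewrite list_sum_R_app; f_equal; simpl flat_map.
rewrite app_nil_r, map_map, Nat.sub_0_r.
assert (Hm : INR (S m) <> 0) by (apply not_0_INR; lia).
generalize (decr_tuples k m) as s; intros s.
induction s as [|l s IH].
- unfold list_sum_R; simpl; unfold Rdiv; ring.
- cbn [map]; unfold list_sum_R in *; cbn [fold_right]; rewrite Rdiv_plus_distr.
  f_equal; [|exact IH].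
  unfold list_prod_R; cbn [map fold_right]; unfold Rdiv.
  rewrite Rinv_mult; ring.
Qed.

Lemma mharm_ge_0 (k m : nat) : 0 <= mharm k m.
Proof.
revert m; induction k as [|k IHk]; intros m; [rewrite mharm_0; lra|].
induction m as [|m IHm]; [rewrite mharm_S_0; lra|].
rewrite mharm_S_S; apply Rplus_le_le_0_compat; [exact IHm|].
apply Rdiv_le_0_compat; [apply IHk|apply lt_0_INR; lia].
Qed.

(** Any geometric growth rate above [1] is enough for the convergence of power
    series in the unit disc.  With the factor [1 / (m + 1)] bounded by [1], the
    recurrence [mharm_S_S] preserves the bound: if [K = 1 / (rho - 1)], then
    [K^(k+1) rho^m + K^k rho^m = K^(k+1) rho^(m+1)]. *)
Lemma mharm_le_geom (rho : R) (k m : nat) :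
  1 < rho -> mharm k m <= (/ (rho - 1)) ^ k * rho ^ m.
Proof.
intros Hrho; assert (HK : 0 < / (rho - 1)) by (apply Rinv_0_lt_compat; lra).
revert m; induction k as [|k IHk]; intros m.
- rewrite mharm_0; simpl; rewrite Rmult_1_l; apply pow_R1_Rle; lra.
- induction m as [|m IHm].
  + rewrite mharm_S_0; apply Rmult_le_pos; apply pow_le; lra.
  + rewrite mharm_S_S.
    assert (Hdiv : mharm k m / INR (S m) <= mharm k m).
    { rewrite <- (Rmult_1_r (mharm k m)) at 2.
      apply Rmult_le_compat_l; [apply mharm_ge_0|].
      rewrite <- Rinv_1; apply Rinv_le_contravar; [lra|].
      rewrite S_INR; pose proof (pos_INR m); lra. }
    replace ((/ (rho - 1)) ^ S k * rho ^ S m) with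
      ((/ (rho - 1)) ^ S k * rho ^ m + (/ (rho - 1)) ^ k * rho ^ m)
      by (simpl; field; lra).
    specialize (IHk m); lra.
Qed.

Definition hsum (k : nat) (x : C) (N : nat) : C :=
  Csum (fun m => mharm k m * x ^ m)%C N.

Lemma one_minus_mult_hsum_0 (x : C) (N : nat) :
  ((1 - x) * hsum 0 x N = 1 - x ^ S N)%C.
Proof.
unfold hsum; induction N as [|N IH].
- rewrite sum_O, mharm_0; simpl; ring.
- rewrite sum_Sn, mharm_0.
  change (plus (G := C_Ring)) with Cplus.
  rewrite Cmult_plus_distr_l, IH; simpl; ring.
Qed.

(** Multiplication by [1 - x] replaces the coefficients by their consecutive
    differences, which [mharm_S_S] computes.  The sum on the right is the
    termwise primitive of [hsum k], which drives the induction on [k]; the last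
    term is the price of truncation. *)
Lemma one_minus_mult_hsum_S (k : nat) (x : C) (N : nat) :
  ((1 - x) * hsum (S k) x N =
   Csum (fun m => mharm k m / INR (S m) * x ^ S m)%C N -
   mharm (S k) (S N) * x ^ S N)%C.
Proof.
assert (Hstep : forall m, RtoC (mharm (S k) (S m)) =
                          (mharm (S k) m + mharm k m / INR (S m))%C).
{ intros m; rewrite mharm_S_S, RtoC_plus, RtoC_div; [reflexivity|].
  apply not_0_INR; lia. }
unfold hsum; induction N as [|N IH].
- rewrite !sum_O, Hstep, mharm_S_0; simpl Cpow; ring.
- rewrite !sum_Sn; change (plus (G := C_Ring)) with Cplus.
  rewrite Cmult_plus_distr_l, IH, (Hstep (S N)); simpl Cpow; ring.
Qed.

(** * The path 1 - exp(-2it) and the kernel of the integral *)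

(** The path along which the power series is evaluated: [- log (1 - arc t)] is
    [2it]. *)
Definition arc (t : R) : C := (1 - Cexp (- (2 * Ci * t)))%C.

Lemma arc_pair (t : R) : arc t = (1 - cos (2 * t), sin (2 * t)).
Proof.
unfold arc, Cexp; simpl.
replace (- ((2 * 0 - 0 * 1) * t - (2 * 1 + 0 * 0) * 0)) with 0 by ring.
replace (- ((2 * 0 - 0 * 1) * 0 + (2 * 1 + 0 * 0) * t)) with (- (2 * t)) by ring.
rewrite exp_0, cos_neg, sin_neg.
apply injective_projections; simpl; ring.
Qed.

Lemma arc_0 : arc 0 = 0.
Proof.
rewrite arc_pair, Rmult_0_r, cos_0, sin_0.
apply injective_projections; simpl; ring.
Qed.

Lemma Cmod_arc (t : R) : 0 <= t <= PI -> Cmod (arc t) = 2 * sin t.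
Proof.
intros Ht; pose proof (sin_ge_0 t (proj1 Ht) (proj2 Ht)) as Hs.
rewrite arc_pair; unfold Cmod; simpl fst; simpl snd.
rewrite cos_2a_sin, sin_2a.
replace (_ + _) with ((2 * sin t) * (2 * sin t)).
- apply sqrt_square; lra.
- pose proof (sin2_cos2 t) as H; unfold Rsqr in H.
  replace ((2 * sin t * cos t) ^ 2) with
    (4 * (sin t * sin t) * (cos t * cos t)) by ring.
  replace (cos t * cos t) with (1 - sin t * sin t) by lra; ring.
Qed.

Lemma is_Cderive_arc (t : R) : is_Cderive arc t (2 * Ci * (1 - arc t))%C.
Proof.
replace (2 * Ci * (1 - arc t))%C with
  (0 - (- (2 * Ci)) * 1 * Cexp (- (2 * Ci) * t))%C.
- apply (is_derive_ext (fun s : R => 1 - Cexp (- (2 * Ci) * s))%C).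
  + intros s; unfold arc; do 2 f_equal; ring.
  + apply is_Cderive_minus; [apply is_Cderive_const|].
    apply (is_Cderive_Cexp (fun s : R => - (2 * Ci) * s)%C), is_Cderive_scal.
    apply (is_Cderive_RtoC (fun s => s)), (is_derive_id (K := R_AbsRing)).
- unfold arc; replace (- (2 * Ci) * t)%C with (- (2 * Ci * t))%C by ring; ring.
Qed.

(** Since [arc t = 2i sin t e^(-it)], its logarithmic derivative is [cot t - i];
    the right-hand side is its derivative as computed in [is_Cderive_arc]. *)
Lemma arc_logderiv (t : R) :
  sin t <> 0 ->
  ((cos t / sin t - Ci) * arc t = 2 * Ci * (1 - arc t))%C.
Proof.
intros Hs.
assert (Hs' : RtoC (sin t) <> 0) by (intros H; apply Hs; now injection H).
assert (H : ((cos t - Ci * sin t) * arc t = sin t * (2 * Ci * (1 - arc t)))%C).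
{ rewrite arc_pair, cos_2a_sin, sin_2a.
  pose proof (sin2_cos2 t) as H; unfold Rsqr in H.
  apply injective_projections; simpl.
  - ring.
  - match goal with |- ?a = ?b => enough (a - b = 0) by lra end.
    match goal with |- ?a = _ =>
      replace a with (2 * sin t * (sin t * sin t + cos t * cos t - 1)) by ring
    end.
    rewrite H; ring. }
replace (cos t / sin t - Ci)%C with ((cos t - Ci * sin t) / sin t)%C
  by (field; exact Hs').
unfold Cdiv; rewrite <- Cmult_assoc, (Cmult_comm (/ sin t)), Cmult_assoc, H.
field; exact Hs'.
Qed.

Lemma Cmod_Cexp (w : C) : Cmod (Cexp w) = exp (Re w).
Proof.
unfold Cexp; rewrite Cmod_mult, Cmod_R.
rewrite Rabs_pos_eq by (left; apply exp_pos).
unfold Cmod; simpl fst; simpl snd.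
replace (cos (Im w) ^ 2 + sin (Im w) ^ 2) with 1.
- rewrite sqrt_1; ring.
- pose proof (sin2_cos2 (Im w)) as H; unfold Rsqr in H; lra.
Qed.

(** A branch of [(arc t / arc z)^a]. *)
Definition kernel (a z t : R) : C :=
  Cexp (a * (ln (sin t / sin z) + Ci * (z - t))).

Lemma Cmod_kernel (a z t : R) :
  Cmod (kernel a z t) = Rpower (sin t / sin z) a.
Proof.
unfold kernel; rewrite Cmod_Cexp; unfold Rpower; f_equal; simpl; ring.
Qed.

Lemma kernel_diag (a z : R) : sin z <> 0 -> kernel a z z = 1.
Proof.
intros Hz; unfold kernel.
replace (sin z / sin z) with 1 by (field; exact Hz).
rewrite ln_1.
replace (a * (0 + Ci * (z - z)))%C with (RtoC 0) by ring.
unfold Cexp; simpl; rewrite exp_0, cos_0, sin_0.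
apply injective_projections; simpl; ring.
Qed.

Lemma is_Cderive_kernel (a z t : R) :
  0 < sin z -> 0 < sin t ->
  is_Cderive (kernel a z) t (a * (cos t / sin t - Ci) * kernel a z t)%C.
Proof.
intros Hz Ht.
apply (is_Cderive_Cexp (fun s : R => a * (ln (sin s / sin z) + Ci * (z - s)))%C).
apply is_Cderive_scal.
replace (cos t / sin t - Ci)%C with
  (RtoC (cos t / sin t) + Ci * (0 - 1))%C.
- apply is_Cderive_plus.
  + apply (is_Cderive_RtoC (fun s => ln (sin s / sin z))).
    auto_derive; [apply Rdiv_lt_0_compat; lra|field; lra].
  + apply is_Cderive_scal, is_Cderive_minus; [apply is_Cderive_const|].
    apply (is_Cderive_RtoC (fun s => s)), (is_derive_id (K := R_AbsRing)).
- rewrite RtoC_div by lra; ring.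
Qed.

(** * Uniform approximation of the generating function *)

Lemma is_Cderive_hsum (f : R -> C) (k N : nat) (t : R) (l : C) :
  is_Cderive f t l ->
  is_Cderive (fun s => hsum k (f s) N) t
    (Csum (fun m => mharm k m * (INR m * f t ^ pred m * l)) N)%C.
Proof.
intros Hf; apply (is_Cderive_sum (fun m s => mharm k m * f s ^ m)%C).
intros m; now apply is_Cderive_scal, is_Cderive_pow.
Qed.

Lemma Csum_mult_l (c : C) (u : nat -> C) (N : nat) :
  Csum (fun n => c * u n)%C N = (c * Csum u N)%C.
Proof. exact (sum_n_mult_l (K := C_Ring) c u N). Qed.

Lemma INR_fact_C_neq_0 (k : nat) : RtoC (INR (fact k)) <> 0.
Proof. intros H; apply (INR_fact_neq_0 k); now injection H. Qed.

Lemma INR_S_C_neq_0 (k : nat) : RtoC (INR (S k)) <> 0.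
Proof. intros H; apply (not_0_INR (S k)); [lia|]; now injection H. Qed.

Lemma is_Cderive_exp_term (k : nat) (t : R) :
  is_Cderive (fun s : R => (2 * Ci * s) ^ S k / INR (fact (S k)))%C t
    (2 * Ci * ((2 * Ci * t) ^ k / INR (fact k)))%C.
Proof.
apply (is_derive_ext (fun s : R => / INR (fact (S k)) * (2 * Ci * s) ^ S k)%C).
{ intros s; apply Cmult_comm. }
replace (2 * Ci * ((2 * Ci * t) ^ k / INR (fact k)))%C with
  (/ INR (fact (S k)) * (INR (S k) * (2 * Ci * t) ^ pred (S k) * (2 * Ci * 1)))%C.
- apply is_Cderive_scal, (is_Cderive_pow (fun s : R => 2 * Ci * s)%C),
    is_Cderive_scal.
  apply (is_Cderive_RtoC (fun s => s)), (is_derive_id (K := R_AbsRing)).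
- rewrite fact_simpl, mult_INR, RtoC_mult; simpl pred.
  pose proof (INR_fact_C_neq_0 k); pose proof (INR_S_C_neq_0 k).
  field; now split.
Qed.

(** Along the path, [d(x^(m+1) / (m+1)) = x^m x'] with [x' = 2i (1 - x)]. *)
Lemma is_Cderive_integrated_hsum (k N : nat) (t : R) :
  is_Cderive
    (fun s => Csum (fun m => mharm k m / INR (S m) * arc s ^ S m)%C N) t
    (2 * Ci * ((1 - arc t) * hsum k (arc t) N))%C.
Proof.
unfold hsum; rewrite Cmult_assoc, <- Csum_mult_l.
apply (is_Cderive_sum (fun m s => mharm k m / INR (S m) * arc s ^ S m)%C).
intros m.
replace (2 * Ci * (1 - arc t) * (mharm k m * arc t ^ m))%C with
  (mharm k m / INR (S m) *
   (INR (S m) * arc t ^ pred (S m) * (2 * Ci * (1 - arc t))))%C.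
- apply is_Cderive_scal, is_Cderive_pow, is_Cderive_arc.
- simpl pred; pose proof (INR_S_C_neq_0 m); field; assumption.
Qed.

Lemma Cmod_2Ci : Cmod (2 * Ci) = 2.
Proof. rewrite Cmod_mult, Cmod_R, Cmod_Ci, Rabs_pos_eq by lra; ring. Qed.

(** This is the identity
    [(1 - x) sum_m H_m^[k] x^m = (- log (1 - x))^k / k!] on the path, with a
    geometric error.  The case [k + 1] follows from the case [k] by integration
    from [0], because [(2it)^(k+1) / (k+1)!] and the sum in
    [one_minus_mult_hsum_S] both vanish at [0] and have approximately equal
    derivatives.  The rate is the midpoint of [r] and [1], which leaves room for
    the growth of the coefficients. *)
Lemma hsum_arc_approx (r z : R) (k : nat) :
  0 < r < 1 -> 0 <= z -> (forall t, 0 <= t <= z -> Cmod (arc t) <= r) ->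
  exists M, 0 <= M /\ forall N t, 0 <= t <= z ->
    Cmod ((1 - arc t) * hsum k (arc t) N - (2 * Ci * t) ^ k / INR (fact k))
    <= M * ((1 + r) / 2) ^ N.
Proof.
intros Hr Hz Harc; set (q := (1 + r) / 2).
assert (Hq : r < q < 1) by (unfold q; lra).
assert (HqS : forall n, q ^ S n <= q ^ n).
{ intros n; simpl; rewrite <- (Rmult_1_l (q ^ n)) at 2.
  apply Rmult_le_compat_r; [apply pow_le|]; lra. }
assert (Hpow : forall t n, 0 <= t <= z -> Cmod (arc t ^ n) <= r ^ n).
{ intros t n Ht; rewrite Cmod_pow; apply pow_incr; split;
    [apply Cmod_ge_0|now apply Harc]. }
induction k as [|k [M [HM IH]]].
- exists 1; split; [lra|]; intros N t Ht.
  rewrite one_minus_mult_hsum_0.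
  replace (1 - arc t ^ S N - (2 * Ci * t) ^ 0 / INR (fact 0))%C with
    (- arc t ^ S N)%C by (simpl; field; intros H; injection H; lra).
  rewrite Cmod_opp, Rmult_1_l.
  eapply Rle_trans; [now apply Hpow|].
  eapply Rle_trans; [|apply HqS]; apply pow_incr; lra.
- set (K := / (q / r - 1)).
  assert (Hrho : 1 < q / r).
  { apply (Rmult_lt_reg_r r); [lra|]; replace (q / r * r) with q by (field; lra).
    lra. }
  assert (HK : 0 < K) by (apply Rinv_0_lt_compat; lra).
  exists (z * (2 * M) + K ^ S k); split.
  { apply Rplus_le_le_0_compat; [|apply pow_le; lra].
    apply Rmult_le_pos; lra. }
  intros N t Ht; rewrite one_minus_mult_hsum_S.
  (* f compares the sum without its truncation term to the limit; df is 2i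
     times the error of order k. *)
  set (f := fun s : R =>
    (Csum (fun m => mharm k m / INR (S m) * arc s ^ S m)%C N -
     (2 * Ci * s) ^ S k / INR (fact (S k)))%C).
  set (df := fun s : R => (2 * Ci *
    ((1 - arc s) * hsum k (arc s) N - (2 * Ci * s) ^ k / INR (fact k)))%C).
  assert (Hf : Cmod (f t) <= t * (2 * (M * q ^ N))).
  { apply (Cmod_le_of_deriv f df); [lra| | | |].
    - unfold f; rewrite Cmult_0_r, Cpow_S.
      rewrite (sum_n_ext (G := C_Ring) _ (fun _ => 0 * 0)%C).
      + rewrite Csum_mult_l; unfold Cdiv; ring.
      + intros m.
        change (mharm k m / INR (S m) * arc 0 ^ S m = 0 * 0)%C.
        rewrite arc_0, Cpow_S; ring.
    - intros s Hs; unfold df; unfold Cminus at 1.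
      rewrite Cmult_plus_distr_l.
      replace (2 * Ci * - ((2 * Ci * s) ^ k / INR (fact k)))%C with
        (- (2 * Ci * ((2 * Ci * s) ^ k / INR (fact k))))%C by ring.
      apply is_Cderive_minus;
        [apply is_Cderive_integrated_hsum|apply is_Cderive_exp_term].
    - intros s Hs; eapply is_Cderive_continuous, is_Cderive_scal,
        is_Cderive_minus.
      + apply is_Cderive_mult.
        * apply is_Cderive_minus; [apply is_Cderive_const|apply is_Cderive_arc].
        * apply is_Cderive_hsum, is_Cderive_arc.
      + eapply is_derive_ext; [intros u; apply Cmult_comm|].
        apply is_Cderive_scal, (is_Cderive_pow (fun u : R => 2 * Ci * u)%C),
          is_Cderive_scal.
        apply (is_Cderive_RtoC (fun u => u)), (is_derive_id (K := R_AbsRing)).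
    - intros s Hs; unfold df; rewrite Cmod_mult, Cmod_2Ci.
      apply Rmult_le_compat_l; [lra|]; apply IH; lra. }
  assert (Htail : Cmod (mharm (S k) (S N) * arc t ^ S N) <= K ^ S k * q ^ N).
  { rewrite Cmod_mult, Cmod_R, Rabs_pos_eq by apply mharm_ge_0.
    apply Rle_trans with (K ^ S k * (q / r) ^ S N * r ^ S N).
    - apply Rmult_le_compat;
        [apply mharm_ge_0|apply Cmod_ge_0| |now apply Hpow].
      now apply mharm_le_geom.
    - rewrite Rmult_assoc, <- Rpow_mult_distr.
      replace (q / r * r) with q by (field; lra).
      apply Rmult_le_compat_l; [apply pow_le; lra|apply HqS]. }
  match goal with |- Cmod ?w <= _ =>
    replace w with (f t + - (mharm (S k) (S N) * arc t ^ S N))%C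
      by (unfold f; ring)
  end.
  eapply Rle_trans; [apply Cmod_triangle|]; rewrite Cmod_opp.
  assert (HMq : t * (2 * (M * q ^ N)) <= z * (2 * M) * q ^ N).
  { replace (z * (2 * M) * q ^ N) with (z * (2 * (M * q ^ N))) by ring.
    apply Rmult_le_compat_r; [|lra].
    pose proof (Rmult_le_pos M (q ^ N) HM ltac:(apply pow_le; lra)); lra. }
  lra.
Qed.

(** * Domination near 0 *)

(** The power [(sin t / sin z)^(a+1)], normalised so that its derivative is
    [majorant_deriv].  The factor [cos t / cos z >= 1] in that derivative is what
    allows an explicit primitive. *)
Definition majorant (a z t : R) : R :=
  sin z / ((a + 1) * cos z) * Rpower (sin t / sin z) (a + 1).

Definition majorant_deriv (a z t : R) : R :=
  cos t / cos z * Rpower (sin t / sin z) a.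

Lemma trig_pos (z t : R) :
  0 < t <= z -> z < PI / 2 -> 0 < sin t <= sin z /\ 0 < cos z <= cos t.
Proof.
intros Ht Hz; pose proof PI_RGT_0.
assert (Hs : 0 < sin t) by (apply sin_gt_0; lra).
assert (Hc : 0 < cos z) by (apply cos_gt_0; lra).
split; split; [exact Hs| |exact Hc|].
- apply sin_incr_1; lra.
- apply cos_decr_1; lra.
Qed.

Lemma is_derive_majorant (a z t : R) :
  -1 < a -> z < PI / 2 -> 0 < t <= z ->
  is_derive (majorant a z) t (majorant_deriv a z t).
Proof.
intros Ha Hz Ht; destruct (trig_pos z t Ht Hz) as [Hs Hc].
unfold majorant, majorant_deriv, Rpower.
auto_derive; [apply Rdiv_lt_0_compat; lra|].
fold (sin t / sin z).
replace ((a + 1) * ln (sin t / sin z))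
  with (a * ln (sin t / sin z) + ln (sin t / sin z)) by ring.
rewrite exp_plus, exp_ln by (apply Rdiv_lt_0_compat; lra).
field; lra.
Qed.

Lemma continuous_majorant_deriv (a z t : R) :
  z < PI / 2 -> 0 < t <= z -> continuous (majorant_deriv a z) t.
Proof.
intros Hz Ht; destruct (trig_pos z t Ht Hz) as [Hs Hc].
apply (ex_derive_continuous (V := R_NormedModule)).
unfold majorant_deriv, Rpower; auto_derive.
apply Rdiv_lt_0_compat; lra.
Qed.

Lemma majorant_lim_0 (a z : R) :
  -1 < a -> 0 < z < PI / 2 ->
  filterlim (majorant a z) (at_right 0) (locally 0).
Proof.
intros Ha Hz; destruct (trig_pos z z ltac:(lra) ltac:(lra)) as [Hs Hc].
set (K := sin z / ((a + 1) * cos z)).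
assert (HK : 0 < K) by (apply Rdiv_lt_0_compat; [|apply Rmult_lt_0_compat]; lra).
apply filterlim_locally; intros eps.
assert (HeK : 0 < eps / K) by (apply Rdiv_lt_0_compat; [apply cond_pos|lra]).
(* If sin t < b, then K (sin t / sin z)^(a+1) < eps. *)
set (b := sin z * Rpower (eps / K) (/ (a + 1))).
assert (Hb : 0 < b) by (apply Rmult_lt_0_compat; [lra|apply exp_pos]).
assert (Hd : 0 < Rmin z b) by (apply Rmin_pos; lra).
exists (mkposreal _ Hd); intros t Ht Ht0.
change (Rabs (t - 0) < Rmin z b) in Ht; apply Rabs_def2 in Ht.
assert (Htz : t < z /\ t < b) by (pose proof (Rmin_l z b);
  pose proof (Rmin_r z b); lra).
destruct (trig_pos z t ltac:(lra) ltac:(lra)) as [Hst _].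
change (Rabs (majorant a z t - 0) < eps); rewrite Rminus_0_r.
assert (Hpos : 0 < Rpower (sin t / sin z) (a + 1)) by apply exp_pos.
unfold majorant; fold K; rewrite Rabs_pos_eq by (apply Rmult_le_pos; lra).
apply (Rmult_lt_reg_l (/ K)); [now apply Rinv_0_lt_compat|].
rewrite <- Rmult_assoc, Rinv_l, Rmult_1_l by lra.
rewrite (Rmult_comm (/ K)); fold (eps / K).
replace (eps / K) with (Rpower (Rpower (eps / K) (/ (a + 1))) (a + 1)).
2: { rewrite Rpower_mult; replace (/ (a + 1) * (a + 1)) with 1 by (field; lra).
     now apply Rpower_1. }
apply Rlt_Rpower_l; [lra|]; split; [apply Rdiv_lt_0_compat; lra|].
apply (Rmult_lt_reg_r (sin z)); [lra|].
replace (sin t / sin z * sin z) with (sin t) by (field; lra).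
rewrite Rmult_comm; fold b.
apply Rlt_trans with t; [apply sin_lt_x|]; lra.
Qed.

(** The hypothesis [z <= 1] disposes of the factor [t^k], so that one majorant
    serves for all [k]. *)
Lemma Cmod_integrand_le (k : nat) (a z t : R) :
  z <= 1 -> z < PI / 2 -> 0 < t <= z ->
  Cmod (integrand k a z t) <= majorant_deriv a z t.
Proof.
intros Hz1 Hz Ht; destruct (trig_pos z t Ht Hz) as [Hs Hc].
change (integrand k a z t) with (t ^ k * kernel a z t)%C.
rewrite Cmod_mult, Cmod_kernel, Cmod_pow, Cmod_R, Rabs_pos_eq by lra.
unfold majorant_deriv; apply Rmult_le_compat_r; [left; apply exp_pos|].
apply Rle_trans with 1.
- rewrite <- (pow1 k); apply pow_incr; lra.
- apply (Rmult_le_reg_r (cos z)); [lra|].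
  unfold Rdiv; rewrite Rmult_assoc, Rinv_l; lra.
Qed.

Lemma continuous_integrand (k : nat) (a z t : R) :
  z < PI / 2 -> 0 < t <= z ->
  continuous (U := C_R_NormedModule) (integrand k a z) t.
Proof.
intros Hz Ht; destruct (trig_pos z t Ht Hz) as [Hs Hc].
eapply is_Cderive_continuous, is_Cderive_mult.
- apply is_Cderive_pow.
  apply (is_Cderive_RtoC (fun s => s)), (is_derive_id (K := R_AbsRing)).
- apply is_Cderive_kernel; lra.
Qed.

(** * Partial sums of the series as primitives *)

(** At [t = z] this is a partial sum of the series of the theorem. *)
Definition series_primitive (k : nat) (a z : R) (N : nat) (t : R) : C :=
  Csum (fun m => mharm k m / (INR (S m) + a) *
                 (kernel a z t * arc t ^ S m))%C N.

Definition series_primitive_deriv (k : nat) (a z : R) (N : nat) (t : R) : C :=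
  (2 * Ci * kernel a z t * ((1 - arc t) * hsum k (arc t) N))%C.

Lemma INR_S_plus_C_neq_0 (a : R) (m : nat) :
  -1 < a -> (INR (S m) + a)%C <> 0.
Proof.
intros Ha H; rewrite <- RtoC_plus in H; apply RtoC_inj in H.
rewrite S_INR in H; pose proof (pos_INR m); lra.
Qed.

(** By [arc_logderiv], both factors of [E x^(m+1)] contribute a multiple of
    [E x^m x'], with coefficients [a] and [m + 1]; their sum cancels the
    denominator. *)
Lemma is_Cderive_series_primitive (k : nat) (a z : R) (N : nat) (t : R) :
  -1 < a -> 0 < sin z -> 0 < sin t ->
  is_Cderive (series_primitive k a z N) t (series_primitive_deriv k a z N t).
Proof.
intros Ha Hz Ht; unfold series_primitive_deriv, hsum.
rewrite Cmult_assoc, <- Csum_mult_l.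
apply (is_Cderive_sum (fun m s => mharm k m / (INR (S m) + a) *
                                  (kernel a z s * arc s ^ S m))%C).
intros m.
replace (2 * Ci * kernel a z t * (1 - arc t) * (mharm k m * arc t ^ m))%C with
  (mharm k m / (INR (S m) + a) *
   (a * (cos t / sin t - Ci) * kernel a z t * arc t ^ S m +
    kernel a z t *
      (INR (S m) * arc t ^ pred (S m) * (2 * Ci * (1 - arc t)))))%C.
- apply is_Cderive_scal, is_Cderive_mult; [now apply is_Cderive_kernel|].
  apply is_Cderive_pow, is_Cderive_arc.
- pose proof (arc_logderiv t ltac:(lra)) as Hlog.
  pose proof (INR_S_plus_C_neq_0 a m Ha) as Hm.
  rewrite Cpow_S; simpl pred.
  replace (a * (cos t / sin t - Ci) * kernel a z t * (arc t * arc t ^ m))%C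
    with (a * ((cos t / sin t - Ci) * arc t) * kernel a z t * arc t ^ m)%C
    by ring.
  rewrite Hlog; field; exact Hm.
Qed.

(** Each term is [O(|E| |x|)], and [|E| |x|] is a multiple of [majorant]:
    [(sin t / sin z)^a * 2 sin t].  This is where the primitive is seen to vanish
    at [0], even if [a < 0].  The constant may depend on [N]. *)
Lemma series_primitive_le (k : nat) (a z : R) (N : nat) :
  -1 < a -> z < PI / 2 -> 2 * sin z <= 1 ->
  exists M, forall t, 0 < t <= z ->
    Cmod (series_primitive k a z N t) <= M * majorant a z t.
Proof.
intros Ha Hz Hr.
set (u := fun m => (mharm k m / (INR (S m) + a))%C).
assert (Hterm : forall m t, 0 < t <= z ->
  Cmod (u m * (kernel a z t * arc t ^ S m)) <=
  Cmod (u m) * (2 * (a + 1) * cos z) * majorant a z t).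
{ intros m t Ht; destruct (trig_pos z t Ht Hz) as [Hs Hc].
  pose proof PI_RGT_0.
  rewrite !Cmod_mult, Rmult_assoc; apply Rmult_le_compat_l; [apply Cmod_ge_0|].
  rewrite Cmod_kernel, Cmod_pow, Cmod_arc by lra.
  replace (2 * (a + 1) * cos z * majorant a z t) with
    (Rpower (sin t / sin z) a * (2 * sin t)).
  - apply Rmult_le_compat_l; [left; apply exp_pos|].
    simpl; rewrite <- (Rmult_1_r (2 * sin t)) at 3.
    apply Rmult_le_compat_l; [lra|].
    rewrite <- (pow1 m); apply pow_incr; lra.
  - unfold majorant; rewrite Rpower_plus, Rpower_1
      by (apply Rdiv_lt_0_compat; lra).
    field; lra. }
unfold series_primitive; induction N as [|N [M IH]].
- exists (Cmod (u 0%nat) * (2 * (a + 1) * cos z)); intros t Ht.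
  rewrite sum_O; now apply Hterm.
- exists (M + Cmod (u (S N)) * (2 * (a + 1) * cos z)); intros t Ht.
  rewrite sum_Sn, Rmult_plus_distr_r.
  eapply Rle_trans; [apply Cmod_triangle|].
  apply Rplus_le_compat; [now apply IH|now apply Hterm].
Qed.

Lemma series_primitive_deriv_close (k : nat) (a z : R) (N : nat) (t B : R) :
  z < PI / 2 -> 0 < t <= z ->
  Cmod ((1 - arc t) * hsum k (arc t) N - (2 * Ci * t) ^ k / INR (fact k)) <= B ->
  Cmod (series_primitive_deriv k a z N t -
        (2 * Ci) ^ (k + 1) / INR (fact k) * integrand k a z t)
  <= 2 * B * majorant_deriv a z t.
Proof.
intros Hz Ht HB; destruct (trig_pos z t Ht Hz) as [Hs Hc].
change (integrand k a z t) with (t ^ k * kernel a z t)%C.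
unfold series_primitive_deriv.
pose proof (INR_fact_C_neq_0 k) as Hfact.
match goal with |- Cmod ?w <= _ => replace w with
  (2 * Ci * kernel a z t *
   ((1 - arc t) * hsum k (arc t) N - (2 * Ci * t) ^ k / INR (fact k)))%C
end.
- rewrite Cmod_mult, (Cmod_mult (2 * Ci)), Cmod_2Ci, Cmod_kernel.
  unfold majorant_deriv.
  assert (Hp : 0 < Rpower (sin t / sin z) a) by apply exp_pos.
  assert (H1 : 1 <= cos t / cos z).
  { apply (Rmult_le_reg_r (cos z)); [lra|].
    unfold Rdiv; rewrite Rmult_assoc, Rinv_l; lra. }
  assert (HB0 : 0 <= B) by (eapply Rle_trans; [apply Cmod_ge_0|exact HB]).
  replace (2 * B * (cos t / cos z * Rpower (sin t / sin z) a)) with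
    (2 * Rpower (sin t / sin z) a * (cos t / cos z * B)) by ring.
  apply Rmult_le_compat_l; [lra|].
  apply Rle_trans with (1 * B); [lra|].
  now apply Rmult_le_compat_r.
- rewrite Cpow_add_r, Cpow_1_r, Cpow_mult_l; field; exact Hfact.
Qed.

Theorem theorem3p1 (z a : R) (k : nat)
  (hz : 0 < z < PI / 6) (ha : -1 < a < 1) :
  abs_integrable_0 (integrand k a z) z /\
  is_series (V := C_NormedModule)
    (fun j : nat =>
       let n := S j in
       (mharm k (n - 1) / (INR n + a) * (1 - Cexp (- (2 * Ci * z))) ^ n)%C)
    ((2 * Ci) ^ (k + 1) / INR (fact k) * CInt_0 (integrand k a z) z)%C.
Proof.
pose proof PI_4 as HPI4; pose proof PI_RGT_0 as HPI.
assert (Hz1 : z <= 1) by lra.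
assert (Hz2 : z < PI / 2) by lra.
destruct (trig_pos z z ltac:(lra) Hz2) as [Hsz Hcz].
set (r := 2 * sin z).
assert (Hr : 0 < r < 1).
{ unfold r; split; [lra|].
  pose proof (sin_increasing_1 z (PI / 6)) as H.
  rewrite sin_PI6 in H; lra. }
assert (Harc : forall t, 0 <= t <= z -> Cmod (arc t) <= r).
{ intros t [[Ht|<-] Htz].
  - rewrite Cmod_arc by lra; destruct (trig_pos z t ltac:(lra) Hz2).
    unfold r; lra.
  - rewrite arc_0, Cmod_0; lra. }
pose proof (fun t Ht => is_derive_majorant a z t (proj1 ha) Hz2 Ht) as Hg.
pose proof (fun t Ht => continuous_majorant_deriv a z t Hz2 Ht) as Hdg.
pose proof (majorant_lim_0 a z (proj1 ha) ltac:(lra)) as Hg0.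
pose proof (fun t Ht => continuous_integrand k a z t Hz2 Ht) as Hcont.
pose proof (fun t Ht => Cmod_integrand_le k a z t Hz1 Hz2 Ht) as Hle.
destruct (dominated_RInt_gen_at_0 C_R_CompleteNormedModule (integrand k a z)
  (majorant a z) (majorant_deriv a z) z) as [l Hl];
  [lra|exact Hcont|exact Hg|exact Hdg| |exact Hg0|].
{ intros t Ht; eapply Rle_trans; [|apply (Hle t Ht)].
  right; symmetry; exact (Cmod_norm (integrand k a z t)). }
assert (Hgen : is_RInt_gen (V := C_R_CompleteNormedModule) (integrand k a z)
                 (at_right 0) (at_point z) l)
  by (apply is_RInt_gen_at_right_0; [lra|exact Hcont|exact Hl]).
split; [split|].
- exists l; exact Hgen.
- assert (HcontM : forall t, 0 < t <= z ->
    continuous (fun t => Cmod (integrand k a z t)) t).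
  { intros t Ht.
    apply (continuous_ext (fun t => norm (V := C_R_NormedModule)
                                         (integrand k a z t))).
    - intros s; symmetry; exact (Cmod_norm (integrand k a z s)).
    - exact (continuous_comp _ _ t (Hcont t Ht)
               (filterlim_norm (V := C_R_NormedModule) _)). }
  destruct (dominated_RInt_gen_at_0 R_CompleteNormedModule
    (fun t => Cmod (integrand k a z t))
    (majorant a z) (majorant_deriv a z) z) as [l' Hl'];
    [lra|exact HcontM|exact Hg|exact Hdg| |exact Hg0|].
  + intros t Ht; change (Rabs (Cmod (integrand k a z t)) <= majorant_deriv a z t).
    rewrite Rabs_pos_eq by apply Cmod_ge_0; now apply Hle.
  + exists l'.
    exact (is_RInt_gen_at_right_0 R_CompleteNormedModule _ z l' (proj1 hz)
             HcontM Hl').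
- unfold CInt_0; rewrite (is_RInt_gen_unique _ _ Hgen).
  destruct (hsum_arc_approx r z k Hr ltac:(lra) Harc) as [M [HM Happrox]].
  set (q := (1 + r) / 2) in *.
  set (c := ((2 * Ci) ^ (k + 1) / INR (fact k))%C).
  assert (Hclose : forall N,
    Cmod (series_primitive k a z N z - c * l) <=
    2 * (M * q ^ N) * majorant a z z).
  { intros N.
    destruct (series_primitive_le k a z N (proj1 ha) Hz2 ltac:(unfold r in Hr; lra))
      as [M' HM'].
    apply (at_right_0_primitive_close (integrand k a z)
             (series_primitive k a z N) (series_primitive_deriv k a z N)
             (majorant a z) (majorant_deriv a z) c l z M');
      [lra|exact Hcont| | |exact Hg|exact Hdg| |exact HM'|exact Hg0|exact Hl].
    - intros t Ht; destruct (trig_pos z t Ht Hz2).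
      apply is_Cderive_series_primitive; lra.
    - intros t Ht; destruct (trig_pos z t Ht Hz2).
      eapply is_Cderive_continuous, is_Cderive_mult.
      + apply is_Cderive_scal, is_Cderive_kernel; lra.
      + apply is_Cderive_mult.
        * apply is_Cderive_minus; [apply is_Cderive_const|apply is_Cderive_arc].
        * apply is_Cderive_hsum, is_Cderive_arc.
    - intros t Ht; apply series_primitive_deriv_close; [exact Hz2|exact Ht|].
      apply Happrox; lra. }
  apply filterlim_locally_ball_norm; intros eps.
  assert (Hlim : is_lim_seq (fun N => 2 * M * majorant a z z * q ^ N) 0).
  { replace (Finite 0) with (Rbar_mult (2 * M * majorant a z z) 0)
      by (simpl; f_equal; ring).
    apply is_lim_seq_scal_l, is_lim_seq_geom.
    rewrite Rabs_pos_eq; unfold q; lra. }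
  apply is_lim_seq_spec in Hlim; destruct (Hlim eps) as [N0 HN0].
  exists N0; intros N HN.
  specialize (HN0 N HN); specialize (Hclose N).
  rewrite Rminus_0_r in HN0.
  apply Rle_lt_trans with (Cmod (series_primitive k a z N z - c * l)).
  + right; apply (f_equal (fun w => Cmod (w - c * l)%C)).
    apply (sum_n_ext (G := C_Ring)); intros m; simpl Nat.sub.
    rewrite kernel_diag, Cmult_1_l, Nat.sub_0_r by lra; reflexivity.
  + eapply Rle_lt_trans; [exact Hclose|].
    eapply Rle_lt_trans; [|exact HN0].
    eapply Rle_trans; [|apply Rle_abs]; right; ring.
Qed.
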